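(* Let $n\ge 1$, $N=\{1,\dots,n\}$, let $A\subsetneq N$ with $|A|=l$, and let $\alpha\in\mathcal{IS}_n$ be the idempotent with domain $A$, i.e. the identity map of $A$. Consider the semigroup $(\mathcal{IS}_n,* )$ with $\beta*\gamma=\beta\alpha\gamma$, and let $M$, ordered $A$-partitions of $M$, the sets $T(M_1,\dots,M_k)$ and the posets $\mathrm{Nil}_k$ be as defined in the context. Let $k$ be a positive integer. (i) For every ordered $A$-partition $M=M_1\cup M_2\cup\dots\cup M_k$ of $M$ into $k$ nonempty blocks, the semigroup $T(M_1,\dots,M_k)$ is maximal in $\mathrm{Nil}_k$ (that is, it is a subsemigroup belonging to $\mathrm{Nil}_k$ and is a maximal element of $\mathrm{Nil}_k$ with respect to inclusion). (ii) Different ordered $A$-partitions of $M$ into $k$ nonempty blocks correspond to different subsemigroups $T(M_1,\dots,M_k)$ in $\mathrm{Nil}_k$. (iii) Every maximal subsemigroup in $\mathrm{Nil}_k$ (maximal element of $\mathrm{Nil}_k$ with respect to inclusion) has the form $T(M_1,\dots,M_k)$ for some ordered $A$-partition $M=M_1\cup M_2\cup\dots\cup M_k$ into $k$ nonempty blocks.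
   Context: $\mathcal{IS}_n$ is the symmetric inverse semigroup of all partial injective transformations of $N=\{1,\dots,n\}$ (including the nowhere defined map $0$), under composition of partial maps. Products are composed from left to right, so $(\beta*\gamma)(x)=\gamma(\alpha(\beta(x)))$ whenever the right-hand side is defined. The map $0$ is the zero of $(\mathcal{IS}_n,* )$. Nilpotent subsemigroups: a subsemigroup $S$ of $(\mathcal{IS}_n,* )$ containing $0$ is nilpotent of nilpotency degree $k\ge 1$ if $x_1*x_2*\cdots*x_k=0$ for all $x_1,\dots,x_k\in S$ and, when $k\geq 2$, there exist $y_1,\dots,y_{k-1}\in S$ with $y_1*\cdots*y_{k-1}\ne 0$ (degree $1$ means $S=\{0\}$). Nilpotency is always with respect to the zero $0$. For every positive integer $k$, $\mathrm{Nil}_k$ is the set of all nilpotent subsemigroups of $(\mathcal{IS}_n,* )$ of nilpotency degree at most $k$, partially ordered by inclusion. The set $M$: put $\overline{A}^{(1)}=N\setminus A$, let $\overline{A}^{(2)}=\{x' : x\in N\setminus A\}$ be a disjoint copy of $\overline{A}^{(1)}$, and let $M$ be the disjoint union $\overline{A}^{(1)}\cup A\cup\overline{A}^{(2)}$. For $\beta\in\mathcal{IS}_n$ let $f(\beta)$ be the partial injective transformation of $M$ with $\operatorname{dom}(f(\beta))=\operatorname{dom}(\beta)\subseteq \overline{A}^{(1)}\cup A$ (where $\operatorname{dom}$ denotes domain), $f(\beta)(x)=\beta(x)$ if $\beta(x)\in A$, and $f(\beta)(x)=\beta(x)'\in\overline{A}^{(2)}$ if $\beta(x)\in N\setminus A$.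 An ordered $A$-partition of $M$ into $k$ nonempty blocks is a partition $M=M_1\cup M_2\cup\dots\cup M_k$ into $k$ pairwise disjoint nonempty blocks such that $M_1\supseteq\overline{A}^{(1)}$ and $M_k\supseteq\overline{A}^{(2)}$, where the order of the blocks is taken into account. For such a partition, $T(M_1,\dots,M_k)$ is the set of all $\beta\in\mathcal{IS}_n$ such that, for all $x\in\operatorname{dom}(\beta)$, $x\in M_i$ and $f(\beta)(x)\in M_j$ imply $i<j$.
   Formalization: Part (iii) is stated and proved only for k ≤ l+2; for k > l+2 there is no ordered A-partition of M into k nonempty blocks, while Nil_k still has maximal elements, so (iii) is false there. *)

(* Defs.v *)
From HB Require Import structures.
From mathcomp Require Import all_boot.

Set Implicit Arguments.
Unset Strict Implicit.
Unset Printing Implicit Defensive.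

(* Partial injective transformations of a finite type; [None] means           *)
(* "undefined".                                                               *)
Definition injective_where_defined (X : finType) (f : {ffun X -> option X}) :=
  [forall x, forall y, (f x != None) && (f x == f y) ==> (x == y)].

Record pinj (X : finType) := PInj {
  pinj_fun :> {ffun X -> option X};
  _ : injective_where_defined pinj_fun }.

HB.instance Definition _ (X : finType) := [isSub for @pinj_fun X].
HB.instance Definition _ (X : finType) := [Finite of pinj X by <:].

Lemma pinj_injP (X : finType) (f : {ffun X -> option X}) :
  reflect (forall x y z, f x = Some z -> f y = Some z -> x = y)
          (injective_where_defined f).
Proof.
apply: (iffP forallP) => [inj_f x y z fx fy | inj_f x].
  by have /forallP/(_ y)/implyP := inj_f x; rewrite fx fy eqxx => /(_ isT)/eqP.
apply/forallP => y; apply/implyP => /andP[fx /eqP fxy]; apply/eqP.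
case Efx: (f x) fx => [z|] // _; apply: (inj_f x y z) => //.
by rewrite -fxy.
Qed.

Lemma pinjP (X : finType) (b : pinj X) x y z :
  b x = Some z -> b y = Some z -> x = y.
Proof. by case: b => f /= /pinj_injP; apply. Qed.

Definition dom (X : finType) (b : pinj X) : {set X} := [set x | b x != None].

Lemma pinj0_proof (X : finType) :
  injective_where_defined [ffun x : X => None : option X].
Proof. by apply/pinj_injP => x y z; rewrite ffunE. Qed.

Definition pinj0 (X : finType) : pinj X := PInj (pinj0_proof X).

Lemma pinj_id_proof (X : finType) (A : {set X}) :
  injective_where_defined [ffun x => if x \in A then Some x else None].
Proof.
by apply/pinj_injP => x y z; rewrite !ffunE; do 2!case: ifP => // _ [->].
Qed.

Definition pinj_id (X : finType) (A : {set X}) : pinj X :=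
  PInj (pinj_id_proof A).

Lemma pinj_comp_proof (X : finType) (b c : pinj X) :
  injective_where_defined [ffun x => obind c (b x)].
Proof.
apply/pinj_injP => x y z; rewrite !ffunE.
case Ebx: (b x) => [u|] //=; case Eby: (b y) => [v|] //= cu cv.
by apply: (pinjP Ebx); rewrite Eby (pinjP cu cv).
Qed.

(* Left-to-right product: x is sent to c (b x).                               *)
Definition pinj_comp (X : finType) (b c : pinj X) : pinj X :=
  PInj (pinj_comp_proof b c).

(* The ground set {1, ..., n} is represented by 'I_n = {0, ..., n - 1}.       *)
Notation IS n := (pinj 'I_n).

Section DeformedMultiplication.

Variables (n : nat) (A : {set 'I_n}).

Definition star (b c : IS n) : IS n := pinj_comp (pinj_comp b (pinj_id A)) c.

(* The product of a nonempty sequence; the value on [::] is never used.       *)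
Definition starprod (s : seq (IS n)) : IS n :=
  if s is b :: s' then foldl star b s' else pinj0 _.

Definition subsemigroup0 (S : {set IS n}) : bool :=
  (pinj0 _ \in S) && [forall b in S, forall c in S, star b c \in S].

Definition nilpotent_of_degree (S : {set IS n}) (d : nat) : bool :=
  [&& subsemigroup0 S, 0 < d,
      [forall s : d.-tuple (IS n), all (mem S) s ==> (starprod s == pinj0 _)]
    & (2 <= d) ==>
      [exists s : d.-1.-tuple (IS n),
         all (mem S) s && (starprod s != pinj0 _)]].

Definition Nil_le (k : nat) : {set {set IS n}} :=
  [set S | [exists d : 'I_k.+1, nilpotent_of_degree S d]].

(* [inl x] is the point x of N (the first copy of N \ A together with A),     *)
(* [inr x] is the point x' of the second copy of N \ A.                       *)
Definition M : finType := ('I_n + {x : 'I_n | x \notin A})%type.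

Definition Abar1 : {set M} := [set inl x | x in ~: A].
Definition Abar2 : {set M} := [set inr x | x : {x : 'I_n | x \notin A}].

Definition to_M (y : 'I_n) : M :=
  if insub y is Some y' then inr y' else inl y.

Definition f_fun (b : IS n) : {ffun M -> option M} :=
  [ffun u : M => if u is inl x then omap to_M (b x) else None].

Lemma to_M_inj : injective to_M.
Proof.
move=> y z; rewrite /to_M.
by case: insubP => [y' _ <-|_]; case: insubP => [z' _ <-|_] // [->].
Qed.

Lemma f_proof (b : IS n) : injective_where_defined (f_fun b).
Proof.
apply/pinj_injP => -[x|x] [y|y] z; rewrite !ffunE //.
case Ebx: (b x) => [u|] //= [<-]; case Eby: (b y) => [v|] //= [/to_M_inj uv].
by rewrite uv in Eby; rewrite (pinjP Ebx Eby).
Qed.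

Definition f (b : IS n) : pinj M := PInj (f_proof b).

(* The blocks M_1, ..., M_k are indexed by 'I_k = {0, ..., k - 1}.            *)
Definition ordered_Apartition (k : nat) (Ms : {ffun 'I_k -> {set M}}) : Prop :=
  [/\ forall i, Ms i != set0,
      forall i j, i != j -> [disjoint Ms i & Ms j],
      \bigcup_i Ms i = [set: M],
      forall i : 'I_k, i = 0 :> nat -> Abar1 \subset Ms i
    & forall i : 'I_k, i = k.-1 :> nat -> Abar2 \subset Ms i].

Definition T (k : nat) (Ms : {ffun 'I_k -> {set M}}) : {set IS n} :=
  [set b | [forall x in dom b, forall y, forall i, forall j,
     [&& inl x \in Ms i, f b (inl x) == Some y & y \in Ms j] ==> (i < j)]].

End DeformedMultiplication.

(* Main.v *)
Require Import Defs.
From mathcomp Require Import all_boot.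
From mathcomp Require Import zify.

Set Implicit Arguments.
Unset Strict Implicit.
Unset Printing Implicit Defensive.

(** An ordered A-partition of M is the same thing as a surjective level
    function L from M to {0, ..., k - 1} with value 0 on the first copy of the
    complement of A and value k - 1 on the second ([levelling], [onto]); the
    blocks are the level sets, and T(M_1, ..., M_k) is the set [increasing L]
    of the maps b such that f(b) strictly raises the level ([T_increasing]).

    A subset S of IS_n induces the relation [step S] on M, in which u is
    related to v when f(b) sends u to v for some b in S.  The points of the
    second copy have no successor and those of the first copy no predecessor,
    so a path in M passes through A at each intermediate vertex.  This is
    exactly the condition for the corresponding *-product to be defined
    there: nonzero products of m elements of S are paths of length m.  Hence S
    is in Nil_k if and only if it is a subsemigroup containing 0 and every path
    of [step S] is shorter than k ([Nil_leP]).  In particular [increasing L]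
    is in Nil_k for every levelling L, since levels go up along paths.

    Conversely, if S is in Nil_k, the length of the longest path ending at a
    point is a levelling (once it is set to k - 1 on the second copy), and S is
    contained in the corresponding [increasing L] ([Nil_sub_increasing]).

    Rigidity ([increasing_rigid]): if L is onto and [increasing L] is included
    in [increasing L'], then L = L'.  The inclusion is seen on maps of rank
    one, and says that L u < L v implies L' u < L' v; as L takes each of the k
    values, climbing from level 0 gives L <= L', and descending from level
    k - 1 gives L' <= L.  This yields (ii) at once, and also (i): a member of
    Nil_k above [increasing L] is included in some [increasing L'], so L = L'.

    For (iii), a maximal S is included in [increasing L] for the longest-path
    levelling L, which may miss values.  When k <= l + 2, there are enough
    points in A to spread L into an onto levelling L' such that [increasing L]
    is included in [increasing L'] ([levelling_refine]); by maximality, S is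
    [increasing L']. *)

(** * Finite relations and weights *)

(** The function h is the length of the longest path ending at a given vertex;
    deleting the last edge of such a path gives the third property. *)
Lemma bounded_path_height (V : finType) (e : rel V) k :
    (forall u p, path e u p -> size p < k) ->
  exists h : V -> nat,
    [/\ forall u, h u < k, forall u v, e u v -> h u < h v
      & forall v m, h v = m.+1 -> exists2 u, e u v & h u = m].
Proof.
move=> short.
pose P v m := [exists u, exists p : m.-tuple V, path e u p && (last u p == v)].
have PP v m : reflect (exists u p, [/\ path e u p, last u p = v & size p = m])
                      (P v m).
  apply: (iffP existsP) => [[u /existsP[p /andP[up /eqP lp]]]|].
    by exists u, p; rewrite size_tuple.
  case=> u [p [up lp /eqP sp]].
  by exists u; apply/existsP; exists (Tuple sp); rewrite /= up lp eqxx.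
have exP v : exists m, P v m by exists 0; apply/PP; exists v, [::].
have ubP v m : P v m -> m <= k.
  by case/PP=> u [p [/short up _ <-]]; apply: ltnW.
pose h v := ex_maxn (exP v) (@ubP v).
have hP v : P v (h v) by rewrite /h; case: ex_maxnP.
have h_max v m : P v m -> m <= h v by rewrite /h; case: ex_maxnP => i _; apply.
have h_incr u v : e u v -> h u < h v.
  move=> euv; apply: h_max; apply/PP.
  have /PP[w [p [wp lp sp]]] := hP u.
  exists w, (rcons p v).
  by rewrite rcons_path wp lp euv last_rcons size_rcons sp.
exists h; split=> // [u|v m hv].
  by have /PP[w [p [/short wp _ <-]]] := hP u.
have /PP[w [p [wp lp]]] := hP v; rewrite hv.
case: (lastP p) wp lp => // p' v'.
rewrite rcons_path last_rcons size_rcons => /andP[wp e_v] v'v [sp].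
rewrite v'v in e_v; exists (last w p') => //; apply/eqP; rewrite eqn_leq.
have -> : m <= h (last w p') by apply: h_max; apply/PP; exists w, p'.
by rewrite -ltnS -hv h_incr.
Qed.

(** The function pos is the rank in a list of A sorted by the weight w; a
    sorted list puts elements of smaller weight strictly earlier. *)
Lemma monotone_enumeration (V : finType) (A : {set V}) (w : V -> nat) :
  exists pos : V -> nat,
    [/\ forall x, x \in A -> pos x < #|A|,
        forall x y, x \in A -> y \in A -> w x < w y -> pos x < pos y
      & forall i, i < #|A| -> exists2 x, x \in A & pos x = i].
Proof.
pose le x y := w x <= w y; pose s := sort le (enum A).
have mem_s x : (x \in s) = (x \in A) by rewrite mem_sort mem_enum.
have size_s : size s = #|A| by rewrite size_sort cardE.
exists (index^~ s); split=> [x xA|x y xA yA|i].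
- by rewrite -size_s index_mem mem_s.
- apply: contraTT; rewrite -!leqNgt => le_yx.
  have le_trans : transitive le by move=> ? ? ?; apply: leq_trans.
  apply: (@sorted_leq_index _ le le_trans _ s) => //; rewrite ?mem_s //.
    by move=> ?; apply: leqnn.
  by apply: sort_sorted => ? ?; apply: leq_total.
case: (set_0Vmem A) => [->|[x0 _] lt_i]; first by rewrite cards0.
exists (nth x0 s i); first by rewrite -mem_s mem_nth ?size_s.
by rewrite index_uniq ?size_s // sort_uniq enum_uniq.
Qed.

(** * Nonzero products as paths in M *)

Section Deformed.

Variables (n : nat) (A : {set 'I_n}).

Implicit Types (S : {set IS n}) (b c : IS n) (L : M A -> nat) (u v : M A).

Lemma pinj_eq0 (b : IS n) : (forall x, b x = None) -> b = pinj0 _.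
Proof. by move=> b0; apply/val_inj/ffunP=> x; rewrite ffunE b0. Qed.

Lemma pinj_neq0P (b : IS n) :
  reflect (exists x y, b x = Some y) (b != pinj0 _).
Proof.
apply: (iffP idP) => [nz|[x [y bx]]]; last first.
  by apply: contra_eq_neq bx => ->; rewrite ffunE.
have [x] : exists x, b x != None.
  apply/existsP; apply: contraNT nz => /existsPn b0.
  by apply/eqP/pinj_eq0 => x; apply/eqP; have := b0 x; rewrite negbK.
by case bx: (b x) => [y|] // _; exists x, y.
Qed.

Lemma to_M_in z : z \in A -> to_M A z = inl z.
Proof. by move=> zA; rewrite /to_M insubF // zA. Qed.

Lemma to_M_val (x' : {x : 'I_n | x \notin A}) : to_M A (val x') = inr x'.
Proof. by rewrite /to_M valK. Qed.

Lemma to_M_inl z x : to_M A z = inl x -> z = x /\ z \in A.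
Proof.
by rewrite /to_M; case: insubP => [?|]; rewrite ?negbK // => zA [<-].
Qed.

Lemma star_some b c x y :
  star A b c x = Some y <-> exists z, [/\ b x = Some z, z \in A & c z = Some y].
Proof.
rewrite /star !ffunE; split=> [|[z [-> zA cz]]]; last by rewrite /= ffunE zA.
case: (b x) => [z|] //=; rewrite ffunE; case: ifP => //= zA cz.
by exists z.
Qed.

Definition step S : rel (M A) := fun u v => [exists b in S, f A b u == Some v].

Lemma stepP S u v :
  reflect (exists b x y, [/\ b \in S, b x = Some y, u = inl x & v = to_M A y])
          (step S u v).
Proof.
apply: (iffP exists_inP) => [[b bS]|[b [x [y [bS bx -> ->]]]]]; last first.
  by exists b => //; rewrite ffunE bx.
rewrite ffunE; case: u => // x; case bx: (b x) => [y|] //= /eqP[<-].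
by exists b, x, y.
Qed.

Lemma starprod_rcons b s c :
  starprod A (rcons (b :: s) c) = star A (starprod A (b :: s)) c.
Proof. by rewrite /= foldl_rcons. Qed.

(** The successive images of x under the partial products are the vertices of
    the path. *)
Lemma path_of_starprod S b s x y :
    all (mem S) (b :: s) -> starprod A (b :: s) x = Some y ->
  exists p, [/\ path (step S) (inl x) p, last (inl x) p = to_M A y
              & size p = (size s).+1].
Proof.
elim/last_ind: s y => [|s c IHs] y.
  rewrite /= andbT => bS bx; exists [:: to_M A y]; split=> //=.
  by rewrite andbT; apply/stepP; exists b, x, y.
rewrite -rcons_cons all_rcons starprod_rcons => /andP[cS bsS].
case/star_some=> z [/(IHs _ bsS)[p [xp lp sp]] zA cz].
exists (rcons p (to_M A y)).
rewrite rcons_path xp last_rcons !size_rcons sp lp; split=> //.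
by apply/stepP; exists c, z, y; split=> //; apply: to_M_in.
Qed.

(** A vertex with both a predecessor and a successor is a value of [to_M] of the
    form inl z, hence lies in A; there the identity of A inserted by * is
    defined, so that the maps labelling the edges compose. *)
Lemma starprod_of_path S u p :
    path (step S) u p -> 0 < size p ->
  exists s x y, [/\ all (mem S) s, size s = size p, starprod A s x = Some y
                  & last u p = to_M A y].
Proof.
elim/last_ind: p => // p v IHp; rewrite rcons_path last_rcons size_rcons.
case: p IHp => [_ /= /stepP[b [x [y [bS bx _ ->]]]] _|w p IHp].
  by exists [:: b], x, y; rewrite /= bS.
case/andP=> /IHp[]// s [x [y [sS sp sx ->]]] /stepP[c [z [t [cS cz + ->]]]] _.
case/to_M_inl=> zy yA; rewrite -{z}zy in cz.
exists (rcons s c), x, t; rewrite all_rcons /= cS sS size_rcons sp.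
split=> //; case: s sp sS sx => // b s _ _ sx; rewrite starprod_rcons.
by apply/star_some; exists y.
Qed.

(** Replaces the quantification over nilpotency degrees by a bound on path
    lengths.  From right to left, the degree is the least d for which all
    products of d factors vanish. *)
Lemma Nil_leP S k : 0 < k ->
  reflect (subsemigroup0 A S /\ forall u p, path (step S) u p -> size p < k)
          (S \in Nil_le A k).
Proof.
move=> k_gt0; rewrite inE; apply: (iffP existsP).
  case=> d /and4P[sub d_gt0 /forallP nil _]; split=> // u p up.
  rewrite ltnNge; apply/negP => kp.
  have dp : d <= size p by apply: leq_trans kp; rewrite -ltnS.
  have [||s [x [y [sS /eqP sd sx _]]]] := @starprod_of_path S u (take d p).
  - exact: take_path.
  - by rewrite size_takel.
  move: sd; rewrite size_takel // => sd.
  have /implyP/(_ sS) := nil (Tuple sd); apply/negP.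
  by apply/pinj_neq0P; exists x, y.
case=> sub short.
pose P d := (0 < d) && [forall s : d.-tuple (IS n),
  all (mem S) s ==> (starprod A s == pinj0 _)].
have Pk : P k.
  rewrite /P k_gt0; apply/forallP => s; apply/implyP => sS.
  apply: contraT => /pinj_neq0P[x [y sx]].
  case: s sS sx => [[|b s] //= /eqP sk sS sx]; first by rewrite -sk in k_gt0.
  have [p [/short lt_pk _ sp]] := path_of_starprod sS sx.
  by rewrite sp -sk /= ltnn in lt_pk.
case: (ex_minnP (ex_intro _ k Pk)) => d /andP[d_gt0 nil] min_d.
have dk : d < k.+1 by rewrite ltnS min_d.
exists (Ordinal dk); rewrite /nilpotent_of_degree sub d_gt0 nil /=.
apply/implyP => d_gt1; apply: contraT => /existsPn none.
suff /min_d : P d.-1 by lia.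
rewrite /P; apply/andP; split; first by lia.
apply/forallP => s; apply/implyP => sS.
by have := none s; rewrite sS /= negbK.
Qed.

(** * Levellings *)

(** The level function of an ordered A-partition, except that blocks may be
    empty; [onto] below is the nonemptiness of the blocks. *)
Definition levelling k L :=
  [/\ forall u, L u < k,
      forall x, x \notin A -> L (inl x) = 0
    & forall x', L (inr x') = k.-1].

Definition onto k L := forall i, i < k -> exists u, L u = i.

(** The semigroup T of the partition into the level sets of L. *)
Definition increasing L : {set IS n} :=
  [set b : IS n | [forall x, forall y,
     (b x == Some y) ==> (L (inl x) < L (to_M A y))]].

Lemma increasingP L b :
  reflect (forall x y, b x = Some y -> L (inl x) < L (to_M A y))
          (b \in increasing L).
Proof.
rewrite inE; apply: (iffP forallP) => [incr x y bx|incr x].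
  by have /forallP/(_ y)/implyP := incr x; apply; apply/eqP.
by apply/forallP => y; apply/implyP => /eqP/incr.
Qed.

Lemma step_increasing L u v : step (increasing L) u v -> L u < L v.
Proof. by case/stepP=> b [x [y [/increasingP incr /incr bx -> ->]]]. Qed.

Lemma increasing_subsemigroup L : subsemigroup0 A (increasing L).
Proof.
apply/andP; split; first by apply/increasingP => x y; rewrite ffunE.
apply/forall_inP => b /increasingP bL; apply/forall_inP => c /increasingP cL.
apply/increasingP => x y /star_some[z [/bL + zA /cL]].
by rewrite to_M_in //; apply: ltn_trans.
Qed.

Lemma increasing_Nil k L :
  0 < k -> levelling k L -> increasing L \in Nil_le A k.
Proof.
move=> k_gt0 [ltLk _ _]; apply/(Nil_leP _ k_gt0); split=> [|u p up].
  exact: increasing_subsemigroup.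
suff le_size : size p + L u <= L (last u p).
  by have := ltLk (last u p); lia.
elim: p u up => //= v p IHp u /andP[/step_increasing uv /IHp]; lia.
Qed.

(** Holds for longest-path levels: a point of A on a level at least 2 is reached
    from a point of the level just below, and that point, having a predecessor
    itself, lies in A.  The levels of the points of A thus form, up to 0, an
    initial segment. *)
Definition gap_free L :=
  forall x m, x \in A -> L (inl x) = m.+2 ->
    exists2 y, y \in A & L (inl y) = m.+1.

(** The witness is the longest-path height in [step S], overridden by k - 1 on
    the second copy of the complement of A; this only raises the level of points
    with no successor. *)
Lemma Nil_sub_increasing k S : 0 < k -> S \in Nil_le A k ->
  exists L, [/\ levelling k L, S \subset increasing L & gap_free L].
Proof.
move=> k_gt0 /(Nil_leP _ k_gt0)[_ /bounded_path_height[h [ltk incr pred]]].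
exists (fun u => if u is inr _ then k.-1 else h u); split=> [||x m xA /=].
- split=> // [[x|x']|x xA]; [exact: ltk | lia |].
  case hx: (h _) => [|m] //.
  have [u /stepP[b [_ [y [_ _ _ xE]]]] _] := pred _ _ hx.
  by case/esym/to_M_inl: xE => yx yA; rewrite -yx yA in xA.
- apply/subsetP=> b bS; apply/increasingP => x y bx.
  have lt_h : h (inl x) < h (to_M A y).
    by apply: incr; apply/stepP; exists b, x, y.
  by case: (to_M A y) lt_h (ltk (to_M A y)) => // y'; lia.
- case/pred=> u /stepP[b [y [z [bS bz -> _]]]] hy; exists y => //.
  have [u' /stepP[b' [_ [y' [_ _ _ /esym/to_M_inl[-> yA]]]]] _] := pred _ _ hy.
  by [].
Qed.

(** * Rigidity of surjective levellings *)

Lemma single_proof x y :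
  injective_where_defined [ffun z : 'I_n => if z == x then Some y else None].
Proof.
by apply/pinj_injP => z1 z2 t; rewrite !ffunE; do 2!case: eqP => // ->.
Qed.

Definition single x y : IS n := PInj (single_proof x y).

Lemma single_increasing L x y :
  (single x y \in increasing L) = (L (inl x) < L (to_M A y)).
Proof.
apply/increasingP/idP => [|lt_xy z t]; first by apply; rewrite ffunE eqxx.
by rewrite ffunE; case: eqP => // -> [<-].
Qed.

(** When L u < L v, the point u cannot be in the second copy of the complement
    of A, nor v in the first, so some map of rank one sends u to v. *)
Lemma increasing_sub_lt k L L' u v :
    levelling k L -> increasing L \subset increasing L' ->
  L u < L v -> L' u < L' v.
Proof.
case=> ltLk L0 Lk /subsetP sLL' ltuv.
have [x ux] : exists x, u = inl x.
  case: u ltuv => [x|x']; first by exists x.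
  by have := ltLk v; rewrite Lk; lia.
have [y vy] : exists y, v = to_M A y.
  case: v ltuv => [y|y'] ltuv; last by exists (val y'); rewrite to_M_val.
  exists y; rewrite to_M_in //; apply: contraLR ltuv => /L0->.
  by rewrite ltn0.
rewrite {}ux {}vy in ltuv *.
by rewrite -single_increasing sLL' // single_increasing.
Qed.

(** A chain of points on the levels 0, ..., L v is mapped by L' to a strictly
    increasing sequence, so L' v >= L v; a chain on the levels L v, ..., k - 1
    gives the opposite bound. *)
Lemma increasing_rigid k L L' :
    levelling k L -> onto k L -> levelling k L' ->
  increasing L \subset increasing L' -> L =1 L'.
Proof.
move=> lL ontoL [ltL'k _ _] sLL'; have [ltLk _ _] := lL.
have lt_LL' u v := @increasing_sub_lt k L L' u v lL sLL'.
have leLL' m : forall v, L v = m -> m <= L' v.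
  elim: m => // m IHm v Lv.
  have [|u Lu] := ontoL m; first by have := ltLk v; lia.
  by apply: leq_ltn_trans (IHm u Lu) _; apply: lt_LL'; rewrite Lu Lv.
have leL'L m : forall v, L v = k.-1 - m -> L' v <= k.-1 - m.
  elim: m => [|m IHm] v Lv; first by have := ltL'k v; lia.
  have [le_km|lt_mk] := leqP k.-1 m.
    by move: (IHm v); lia.
  have [|w Lw] := ontoL (k.-1 - m); first by lia.
  have := IHm w Lw; have : L' v < L' w by apply: lt_LL'; lia.
  by lia.
move=> v; apply/eqP; rewrite eqn_leq leLL' //=.
by have := leL'L (k.-1 - L v) v; have := ltLk v; lia.
Qed.

(** * Refining a levelling to a surjective one *)

(** List A in an order compatible with L, pos x being the rank of x (from 0).
    On A, the new level is the larger of L x and pos x + k - 1 - l.  Along the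
    list, L goes up by at most 1 at a time because L is gap-free, and so does
    the second quantity, which runs from at most 1 (this is k <= l + 2) to
    k - 2; hence the maximum takes all values from 1 to k - 2.  It
    raises the level strictly wherever L does, since the rank then increases
    too. *)
Lemma levelling_refine k l L :
    0 < k -> #|A| = l -> k <= l + 2 -> A \proper setT -> levelling k L ->
    gap_free L ->
  exists L',
    [/\ levelling k L', onto k L' & increasing L \subset increasing L'].
Proof.
move=> k_gt0 cardA le_kl /properP[_ [x0 _ x0A]] [ltLk L0 Lk] dense.
have [pos [pos_lt pos_incr pos_onto]] :=
  monotone_enumeration A (fun x => L (inl x)).
rewrite cardA in pos_lt pos_onto.
pose R x := maxn (L (inl x)) (pos x + k.-1 - l).
pose L' (u : M A) := if u is inl x then if x \in A then R x else 0 else k.-1.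
have R_lt x : x \in A -> R x < k.
  by move=> /pos_lt ltl; rewrite gtn_max ltLk /=; lia.
exists L'; split.
- split=> // [[x|x'] /=|x /= /negbTE->] //; last by lia.
  by case: ifP => // /R_lt.
- move=> m lt_mk; have [->|m_gt0] := posnP m.
    by exists (inl x0); rewrite /= (negbTE x0A).
  have [->|m_neq] := eqVneq m k.-1; first by exists (inr (Sub x0 x0A)).
  (* The last element z of A has new level at least k - 2, hence at least m;
     the first x whose new level reaches m then has level exactly m. *)
  have [|z zA pos_z] := pos_onto l.-1; first by lia.
  have leRz : (z \in A) && (m <= R z).
    by rewrite zA leq_max pos_z; apply/orP; right; lia.
  case: (@arg_minnP _ z (fun x => (x \in A) && (m <= R x)) pos leRz).
  move=> x /andP[xA leRx] min_x.
  exists (inl x); rewrite /= xA; apply/eqP.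
  rewrite eqn_leq leRx andbT /R geq_max.
  apply/andP; split; rewrite leqNgt; apply/negP.
    case Lx: (L (inl x)) => [|[|p]] lt_m; [lia | lia |].
    have [y yA Ly] := dense _ _ xA Lx.
    have : pos y < pos x by apply: pos_incr => //; rewrite Lx Ly.
    rewrite ltnNge => /negP; apply; apply: min_x.
    by rewrite yA leq_max Ly -ltnS lt_m.
  move=> lt_m; have [|y yA pos_y] := pos_onto (pos x).-1.
    by have := pos_lt x xA; lia.
  suff /min_x : (y \in A) && (m <= R y) by lia.
  by rewrite yA leq_max pos_y; apply/orP; right; lia.
- apply/subsetP => b /increasingP incr; apply/increasingP => x y /incr {incr}.
  rewrite /L' /to_M; case: insubP => [y' _ _|/negbNE yA] lt_xy.
    rewrite Lk in lt_xy; case: ifP => [/pos_lt lt_l|_]; last by lia.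
    by rewrite /R gtn_max lt_xy /=; lia.
  have Ly_gt0 := leq_ltn_trans (leq0n _) lt_xy.
  rewrite yA /R; case: ifP => [xA|_]; last by rewrite leq_max Ly_gt0.
  rewrite gtn_max !leq_max lt_xy /=.
  by have := pos_incr _ _ xA yA lt_xy; move: (L (inl y)) Ly_gt0 => m; lia.
Qed.

(** * Ordered A-partitions as level sets *)

Lemma blocks_of_levelling k L : levelling k L -> onto k L ->
  ordered_Apartition [ffun i : 'I_k => [set u | L u == i]].
Proof.
case=> ltLk L0 Lk ontoL; split=> [i|i j ij||i i0|i ik]; rewrite ?ffunE.
- have [u Lu] := ontoL i (ltn_ord i).
  by apply/set0Pn; exists u; rewrite inE Lu.
- rewrite -setI_eq0; apply/eqP/setP => u; rewrite !inE.
  by apply: contraNF ij => /andP[/eqP-> /eqP/val_inj->].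
- apply/setP => u; rewrite inE; apply/bigcupP; exists (Ordinal (ltLk u)) => //.
  by rewrite ffunE inE.
- by apply/subsetP => _ /imsetP[x + ->]; rewrite !inE => /L0->; rewrite i0.
- by apply/subsetP => _ /imsetP[x _ ->]; rewrite inE Lk ik.
Qed.

Lemma levelling_of_blocks k (Ms : {ffun 'I_k -> {set M A}}) :
    0 < k -> ordered_Apartition Ms ->
  exists L, [/\ levelling k L, onto k L
    & Ms = [ffun i : 'I_k => [set u | L u == i]]].
Proof.
move=> k_gt0 [ne disj cov M1 Mk].
have ex_block u : exists i, u \in Ms i.
  have : u \in \bigcup_i Ms i by rewrite cov inE.
  by case/bigcupP=> i _; exists i.
pose L u : nat := xchoose (ex_block u).
have LE i u : (u \in Ms i) = (L u == i).
  have uL := xchooseP (ex_block u).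
  apply/idP/eqP => [ui|/val_inj <- //].
  congr val; apply: contraTeq uL => /disj.
  rewrite disjoint_sym => /disjointFr/(_ ui) -> //.
exists L; split; [split| |].
- by move=> u; apply: ltn_ord.
- move=> x xA; apply/eqP; rewrite -(LE (Ordinal k_gt0)).
  by apply: (subsetP (M1 _ _)) => //; apply: imset_f; rewrite inE.
- have lt_k : k.-1 < k by lia.
  move=> x'; apply/eqP; rewrite -(LE (Ordinal lt_k)).
  by apply: (subsetP (Mk _ _)) => //; apply: imset_f.
- move=> i ltik; have /set0Pn[u] := ne (Ordinal ltik).
  by rewrite LE => /eqP; exists u.
- by apply/ffunP => i; apply/setP => u; rewrite ffunE inE LE.
Qed.

Lemma T_increasing k L : levelling k L ->
  T [ffun i : 'I_k => [set u | L u == i]] = increasing L.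
Proof.
case=> ltLk _ _; apply/setP => b; rewrite inE.
apply/forall_inP/increasingP => [Tb x y bx|incr x _].
  have xb : x \in dom b by rewrite inE bx.
  have /forallP/(_ (to_M A y))/forallP/(_ (Ordinal (ltLk (inl x)))) := Tb x xb.
  move=> /forallP/(_ (Ordinal (ltLk (to_M A y))))/implyP; apply.
  by rewrite !ffunE !inE bx /= !eqxx.
apply/forallP => v; apply/forallP => i; apply/forallP => j; apply/implyP.
rewrite !ffunE !inE => /and3P[/eqP <- + /eqP <-].
by case bx: (b x) => [y|] //= /eqP[<-]; apply: incr.
Qed.

End Deformed.

Theorem theorem14 (n : nat) (A : {set 'I_n}) (l k : nat)
    (n_gt0 : 0 < n) (ltAN : A \proper [set: 'I_n]) (cardA : #|A| = l)
    (k_gt0 : 0 < k) :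
  [/\ (* (i) *)
      forall Ms : {ffun 'I_k -> {set M A}}, ordered_Apartition Ms ->
        maxset (fun S => S \in Nil_le A k) (T Ms),
      (* (ii) *)
      forall Ms Ms' : {ffun 'I_k -> {set M A}},
        ordered_Apartition Ms -> ordered_Apartition Ms' ->
        Ms <> Ms' -> T Ms <> T Ms'
    & (* (iii) *)
      k <= l + 2 ->
      forall S : {set IS n}, maxset (fun S' => S' \in Nil_le A k) S ->
        exists2 Ms : {ffun 'I_k -> {set M A}},
          ordered_Apartition Ms & S = T Ms].
Proof.
split=> [Ms /(levelling_of_blocks k_gt0)[L [lL ontoL ->]]|Ms Ms'|].
- rewrite T_increasing //; apply/maxsetP; split=> [|S SNil sLS].
    exact: increasing_Nil.
  have [L' [lL' sSL' _]] := Nil_sub_increasing k_gt0 SNil.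
  have LL' := increasing_rigid lL ontoL lL' (subset_trans sLS sSL').
  apply/eqP; rewrite eqEsubset sLS andbT; apply: subset_trans sSL' _.
  apply/subsetP => b /increasingP incr; apply/increasingP => x y /incr.
  by rewrite !LL'.
- move=> /(levelling_of_blocks k_gt0)[L [lL ontoL ->]].
  move=> /(levelling_of_blocks k_gt0)[L' [lL' _ ->]] neq.
  rewrite !T_increasing // => LL'; apply: neq.
  apply/ffunP => i; apply/setP => u; rewrite !ffunE !inE.
  by rewrite (increasing_rigid lL ontoL lL') ?LL'.
- move=> le_kl S /maxsetP[SNil maxS].
  have [L [lL sSL dense]] := Nil_sub_increasing k_gt0 SNil.
  have [L' [lL' ontoL' sLL']] :=
    levelling_refine k_gt0 cardA le_kl ltAN lL dense.
  exists [ffun i : 'I_k => [set u | L' u == i]].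
    exact: blocks_of_levelling.
  rewrite T_increasing //; apply/esym/maxS; first exact: increasing_Nil.
  exact: subset_trans sLL'.
Qed.
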